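(* Complex Hadamard matrices arising from the conference matrix construction are not of Dita-type.
   Context: A conference matrix of order $N$ is an $N\times N$ matrix $C$ with $CC^T=C^TC=(N-1)I$, $C_{ii}=0$ and $C_{ij}\in\{-1,1\}$ for $i\neq j$. The conference matrix construction: if $C$ is a real symmetric conference matrix, then $H=I+\mathbf{i}C$ is a complex Hadamard matrix. A complex Hadamard matrix of order $N$ is an $N\times N$ matrix $H$ with $|H_{i,j}|=1$ and $HH^\ast=NI$. Two Hadamard matrices $H_1,H_2$ are equivalent if $H_1=D_1P_1H_2P_2D_2$ with $D_1,D_2$ diagonal unitary and $P_1,P_2$ permutation matrices. Dita's construction: if $M=(m_{ij})$ is a complex Hadamard matrix of order $k$ and $N_1,\dots,N_k$ are complex Hadamard matrices of order $n$, then the block matrix $K$ whose $(i,j)$ block is $m_{ij}N_j$ is a complex Hadamard matrix of order $nk$. A complex Hadamard matrix is Dita-type if it is equivalent to a matrix $K$ arising in this way.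
   Formalization: Dita-type is taken with both k ≥ 2 and n ≥ 2; without this restriction every complex Hadamard matrix is trivially Dita-type (take n = 1, M = H, or k = 1, N_1 = H) and the claim would be false. *)

(* Defs.v *)
From mathcomp Require Import all_boot all_order all_algebra.
From mathcomp Require Import reals complex.

Set Implicit Arguments.
Unset Strict Implicit.
Unset Printing Implicit Defensive.

Import Order.TTheory GRing.Theory Num.Theory.

Local Open Scope ring_scope.
Local Open Scope complex_scope.
Local Open Scope sesquilinear_scope.

Definition conference_matrix (R : realType) (N : nat) (C : 'M[R]_N) : Prop :=
  [/\ C *m C^T = (N%:R - 1)%:M,
      C^T *m C = (N%:R - 1)%:M,
      forall i, C i i = 0
    & forall i j, i != j -> C i j = -1 \/ C i j = 1].

Definition complex_hadamard (R : realType) (N : nat) (H : 'M[R[i]]_N) : Prop :=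
  (forall i j, `|H i j| = 1) /\ H *m H^t* = N%:R%:M.

Definition conference_construction (R : realType) (N : nat) (C : 'M[R]_N) :
    'M[R[i]]_N :=
  1%:M + 'i%C *: map_mx (real_complex R) C.

Definition arises_from_conference (R : realType) (N : nat) (H : 'M[R[i]]_N) :
    Prop :=
  exists C : 'M[R]_N,
    [/\ conference_matrix C, C^T = C & H = conference_construction C].

Definition diagonal_unitary (R : realType) (N : nat) (D : 'M[R[i]]_N) : Prop :=
  is_diag_mx D /\ D \is unitarymx.

Definition hadamard_equiv (R : realType) (N : nat) (H1 H2 : 'M[R[i]]_N) :
    Prop :=
  exists D1 P1 P2 D2 : 'M[R[i]]_N,
    [/\ diagonal_unitary D1 /\ diagonal_unitary D2,
        is_perm_mx P1 /\ is_perm_mx P2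
      & H1 = D1 *m P1 *m H2 *m P2 *m D2].

Definition dita_matrix (R : realType) (k n : nat) (M : 'M[R[i]]_k)
    (Ns : 'I_k -> 'M[R[i]]_n) : 'M[R[i]]_(\sum_(i < k) n) :=
  \mxblock_(i < k, j < k) (M i j *: Ns j).

(* The bounds k, n > 1 exclude the degenerate factorisations: with k = 1 or
   n = 1 every complex Hadamard matrix is a Dita matrix built from itself.
   The matrix [dita_matrix M Ns] has the order \sum_(i < k) n, which is k * n
   but not syntactically N, hence the cast. *)
Definition dita_type (R : realType) (N : nat) (H : 'M[R[i]]_N) : Prop :=
  exists (k n : nat) (M : 'M[R[i]]_k) (Ns : 'I_k -> 'M[R[i]]_n)
         (eN : (\sum_(i < k) n)%N = N),
    [/\ (1 < k)%N /\ (1 < n)%N,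
        complex_hadamard M,
        forall j, complex_hadamard (Ns j)
      & hadamard_equiv H (castmx (eN, eN) (dita_matrix M Ns))].

(* Main.v *)
Require Import Defs.
From mathcomp Require Import all_boot all_order all_algebra.
From mathcomp Require Import reals complex.
From mathcomp Require Import fingroup perm ring.

(** In a Dita matrix, two rows with the same position in different row blocks
    are proportional along each column block; this vanishing of [2 x 2] minors
    survives equivalence.  In [H = I + iC], choose rows [u], [v] in this way and
    a column [c] other than [u] in the column block of [u].  The minor gives
    [H v c = H u c * H v u], as [H u u = 1].  Off-diagonal entries of [H] are
    [i] or [-i], so if [c <> v] the left side is imaginary and the right side
    real, while if [c = v] symmetry turns the equation into [1 = -1]. *)

Local Open Scope ring_scope.

Set Implicit Arguments.
Unset Strict Implicit.
Unset Printing Implicit Defensive.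

Import GRing.Theory Num.Theory.

Lemma hadamard_equiv_entries (R : realType) (N : nat) (H1 H2 : 'M[R[i]]_N) :
  hadamard_equiv H1 H2 ->
  exists (s t : 'S_N) (d e : 'rV[R[i]]_N),
    forall u c, H1 u c = d 0 u * H2 (s u) (t c) * e 0 c.
Proof.
move=> [D1 [P1 [P2 [D2 [[[/diag_mxP[d ->] _] [/diag_mxP[e ->] _]]]]]]].
move=> [/is_perm_mxP[s ->] /is_perm_mxP[t ->]] ->.
(* Right multiplication by [perm_mx t] moves columns by [t], so column [c] of the product is column
   [t^-1 c] of [H2]. *)
exists s, (t^-1)%g, d, e => u c.
have -> : perm_mx t = perm_mx (t^-1)^-1 :> 'M[R[i]]_N by rewrite invgK.
rewrite -[_ *m _ *m H2]mulmxA -row_permE -[_ *m perm_mx _]mulmxA.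
by rewrite -col_permE mul_mx_diag mul_diag_mx !mxE.
Qed.

Section DitaMatrix.

Variables (R : realType) (k n : nat).
Variables (M : 'M[R[i]]_k) (Ns : 'I_k -> 'M[R[i]]_n).

Lemma dita_matrixE (i j : 'I_k) (a b : 'I_n) :
  dita_matrix M Ns (tagnat.Rank i a) (tagnat.Rank j b) = M i j * Ns j a b.
Proof.
have := mxblockK (fun i j => M i j *: Ns j) i j.
by move=> /matrixP/(_ a b); rewrite !mxE.
Qed.

Lemma dita_equiv_minors (H : 'M[R[i]]_(\sum_(i < k) n)) u :
    (1 < k)%N -> (1 < n)%N -> hadamard_equiv H (dita_matrix M Ns) ->
  exists v c, [/\ v != u, u != c & H u u * H v c = H u c * H v u].
Proof.
move=> k_gt1 n_gt1 /hadamard_equiv_entries[s [t [d [e defH]]]].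
have neqP m (x : 'I_m) : (1 < m)%N -> exists y, y != x.
  move=> m_gt1; have /card_gt0P[y yPx] : (0 < #|predC1 x|)%N.
    by rewrite cardC1 card_ord -ltnS prednK // ltnW.
  by exists y.
case defsu: (tagnat.sig (s u)) => [i a].
case deftu: (tagnat.sig (t u)) => [j b].
have su : s u = tagnat.Rank i a by rewrite -[s u]tagnat.sigK defsu.
have tu : t u = tagnat.Rank j b by rewrite -[t u]tagnat.sigK deftu.
have [[i' ni'i] [b' nb'b]] := (neqP _ i k_gt1, neqP _ b n_gt1).
(* In Dita coordinates, [v] changes the row block of [u] but keeps the position [a], while [c] keeps
   the column block [j] but changes the position. *)
exists ((s^-1)%g (tagnat.Rank i' a)), ((t^-1)%g (tagnat.Rank j b')); split.
- rewrite -(inj_eq (@perm_inj _ s)) permKV su.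
  by rewrite -val_eqE tagnat.eq_Rank negb_and ni'i.
- rewrite eq_sym -(inj_eq (@perm_inj _ t)) permKV tu.
  by rewrite -val_eqE tagnat.eq_Rank eqxx.
(* Both products contain [M i j], [M i' j], [Ns j a b], [Ns j a b'] and the same four scalars from
   [d] and [e]. *)
by rewrite !defH !permKV su tu !dita_matrixE; ring.
Qed.

End DitaMatrix.

Section ConferenceConstruction.

Variables (R : realType) (N : nat) (C : 'M[R]_N).
Hypothesis confC : conference_matrix C.

Lemma conference_construction_diag u : conference_construction C u u = 1.
Proof.
by case: confC => _ _ C0 _; rewrite !mxE C0 eqxx rmorph0 mulr0 addr0.
Qed.

Lemma conference_construction_offdiag u v : u != v ->
  exists b : bool, conference_construction C u v = (-1) ^+ b * 'i%C.
Proof.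
case: confC => _ _ _ C1 uv; rewrite !mxE (negPf uv) add0r.
by case: (C1 u v uv) => ->; [exists true | exists false];
   rewrite ?rmorphN rmorph1 mulrC.
Qed.

Lemma conference_construction_minor u v c :
    C^T = C -> v != u -> u != c ->
  let H := conference_construction C in H u u * H v c <> H u c * H v u.
Proof.
move=> symC vu uc H; rewrite conference_construction_diag mul1r.
have sqi : 'i%C * 'i%C = -1 :> R[i] by rewrite -expr2 sqr_i.
have N1 : 1 != -1 :> R[i]
    by rewrite eq_sym -subr_eq0 -opprD oppr_eq0 (pnatr_eq0 _ 2).
have [<-|vc] := eqVneq v c.
  have -> : H u v = H v u by rewrite !mxE eq_sym -[in C u v]symC mxE.
  have [b ->] := conference_construction_offdiag vu.
  rewrite conference_construction_diag mulrACA -expr2 sqrr_sign mul1r sqi.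
  by move/eqP; rewrite (negPf N1).
have [b1 ->] := conference_construction_offdiag vc.
have [b2 ->] := conference_construction_offdiag uc.
have [b3 ->] := conference_construction_offdiag vu.
(* Squaring removes the unknown signs: the left side becomes -1, the right side 1. *)
move/(congr1 (fun z => z ^+ 2)); rewrite mulrACA sqi !exprMn !sqrr_sign.
by rewrite !mul1r sqrrN expr1n expr2 sqi => /esym/eqP; rewrite (negPf N1).
Qed.

End ConferenceConstruction.

Theorem theorem4p2 :
  forall (R : realType) (N : nat) (H : 'M[R[i]]_N),
    arises_from_conference H -> ~ dita_type H.
Proof.
move=> R N H [C [confC symC ->]] [k [n [M [Ns [eN]]]]].
(* Replacing [N] by the sum makes the cast an identity. *)
move=> [[k_gt1 n_gt1] _ _]; case: N / eN C confC symC {H} => C confC symC.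
rewrite castmx_id => eqvH.
(* Any index would serve as [u]; the first one exists since [k] and [n] are positive. *)
pose u :=
  tagnat.Rank (p_ := fun=> n) (Ordinal (ltnW k_gt1)) (Ordinal (ltnW n_gt1)).
have [v [c [vu uc]]] := dita_equiv_minors u k_gt1 n_gt1 eqvH.
exact: conference_construction_minor.
Qed.
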